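(* Let $k \ge 2$ be an even integer and let $n \ge 1$ be an integer. Write the $k$-th Bernoulli number as $B_k = N_k/D_k$ with $N_k, D_k$ coprime integers and $D_k \ge 1$. Then $\mu_k(n) = \frac{1}{n}\sum_{j=1}^{n} j^k$ is an integer if and only if $\gcd(n, D_k) = 1$.
   Context: The Bernoulli numbers are defined by $B_0 = 1$ and $(k+1)B_k = -\sum_{j=0}^{k-1}\binom{k+1}{j}B_j$ for $k \ge 1$; equivalently, $\frac{x}{e^x - 1} = \sum_{k\ge 0} B_k \frac{x^k}{k!}$. *)

(* Defs.v *)
From mathcomp Require Import all_boot all_order all_algebra.

Set Implicit Arguments.
Unset Strict Implicit.
Unset Printing Implicit Defensive.

Import Order.TTheory GRing.Theory Num.Theory.

Local Open Scope ring_scope.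

(* [:: B_0; ...; B_{n-1}]. The recursion for B_k uses all earlier values, so
   the list of them is carried along; [bernoulli0] and [bernoulli_rec] below
   recover the defining equations. *)
Fixpoint bernoulli_seq (n : nat) : seq rat :=
  if n is k.+1 then
    let s := bernoulli_seq k in
    rcons s (if k == 0%N then 1
             else - (\sum_(j < k) 'C(k.+1, j)%:R * s`_j) / k.+1%:R)
  else [::].

(* The convention B_1 = - 1/2. *)
Definition bernoulli (k : nat) : rat := (bernoulli_seq k.+1)`_k.

Lemma size_bernoulli_seq n : size (bernoulli_seq n) = n.
Proof. by elim: n => //= n IHn; rewrite size_rcons IHn. Qed.

Lemma nth_bernoulli_seq n j : (j < n)%N -> (bernoulli_seq n)`_j = bernoulli j.
Proof.
elim: n => // n IHn; rewrite ltnS leq_eqVlt => /predU1P[-> //|lt_jn].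
by rewrite /= nth_rcons size_bernoulli_seq lt_jn IHn.
Qed.

Lemma bernoulli0 : bernoulli 0 = 1.
Proof. by []. Qed.

Lemma bernoulli_rec k : (1 <= k)%N ->
  k.+1%:R * bernoulli k = - \sum_(j < k) 'C(k.+1, j)%:R * bernoulli j.
Proof.
case: k => // k _; rewrite {1}/bernoulli [bernoulli_seq _]/=.
rewrite nth_rcons -/(bernoulli_seq k.+1) size_bernoulli_seq ltnn eqxx.
rewrite mulrC divfK ?pnatr_eq0 //; congr (- _).
by apply: eq_bigr => j _; rewrite -/(bernoulli_seq k.+1) nth_bernoulli_seq.
Qed.

Definition mean_power (k n : nat) : rat :=
  (\sum_(1 <= j < n.+1) j%:R ^+ k) / n%:R.

(* Main.v *)
(* By Faulhaber's formula, [mean_power k n] minus [bernoulli k] is [n ^ (k-1)]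
   plus the sum over [1 <= i <= k] of ['C(k, i) B_{k-i} n^i / (i+1)].  Localize
   at [n], i.e. allow denominators coprime to [n].  The same formula, multiplied
   by [n], shows inductively that every [n B_j] lies in the localization.  So
   does [n^(i-1) / (i+1)] for [i >= 2], because [i + 1 < 2^i], and the term
   [i = 1] is [(k/2) (n B_{k-1})] with [k] even; hence the difference is
   [n]-integral.  Finally [n * mean_power k n] is an integer, so the mean is an
   integer iff it is [n]-integral, iff [bernoulli k] is. *)
Require Import Defs.
From HB Require Import structures.
From mathcomp Require Import all_boot all_order all_algebra ring.

Import Order.TTheory GRing.Theory Num.Theory.

Local Open Scope ring_scope.

(** The recursion for [bernoulli] read backwards: multiplication by [m + 1] turns
    ['C(m, i) / (m + 1 - i)] into ['C(m + 1, i)]. *)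
Lemma sum_bin_bernoulli (m : nat) :
  \sum_(r < m.+1) 'C(m, r)%:R * bernoulli (m - r) / r.+1%:R = (m == 0%N)%:R.
Proof.
case: m => [|m]; first by rewrite big_ord1 bernoulli0 bin0 !mul1r invr1.
have m2_neq0 : m.+2%:R != 0 :> rat by rewrite pnatr_eq0.
apply: (mulfI m2_neq0); rewrite mulr0 big_distrr /=.
rewrite (reindex_inj rev_ord_inj) /=.
under eq_bigr => i _.
  have le_im : (i <= m.+1)%N by rewrite -ltnS.
  rewrite subSS subKn // bin_sub // -subSn //.
  have -> : m.+2%:R * ('C(m.+1, i)%:R * bernoulli i / (m.+2 - i)%:R)
    = 'C(m.+2, i)%:R * bernoulli i.
    rewrite !mulrA -natrM mul_bin_down natrM [_ * 'C(_, _)%:R]mulrC mulrAC.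
    by rewrite mulrAC mulrAC mulfK // pnatr_eq0 subn_eq0 -ltnNge.
  over.
by rewrite big_ord_recr /= binSn bernoulli_rec // subrr.
Qed.

(** The integral from [0] to [x] of the Bernoulli polynomial [B_k(t)]. *)
Definition faulhaber (k : nat) (x : rat) : rat :=
  \sum_(i < k.+1) 'C(k, i)%:R * bernoulli (k - i) * (x ^+ i.+1 / i.+1%:R).

Lemma mul_bin_trinomial (k i l : nat) : (l <= i)%N -> (i <= k)%N ->
  ('C(k, i) * 'C(i, l) = 'C(k, l) * 'C(k - l, i - l))%N.
Proof.
move=> le_li le_ik; have le_lk := leq_trans le_li le_ik.
have pos : (0 < l`! * (i - l)`! * (k - i)`!)%N by rewrite !muln_gt0 !fact_gt0.
apply/eqP; rewrite -(eqn_pmul2r pos); apply/eqP; transitivity k`!.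
  by rewrite -(bin_fact le_ik) -(bin_fact le_li) !mulnA.
have le_ilkl : (i - l <= k - l)%N by rewrite leq_sub2r.
rewrite -(bin_fact le_lk) -(bin_fact le_ilkl).
have -> : (k - l - (i - l) = k - i)%N by rewrite subnBA // subnK.
by rewrite -!mulnA; congr muln; rewrite mulnCA.
Qed.

(* For [i < l] the summand is [0], so the truncated [i - l] is harmless. *)
Lemma sum_trinomial_bernoulli (k l : nat) : (l <= k)%N ->
  \sum_(i < k.+1)
    'C(k, i)%:R * 'C(i, l)%:R * bernoulli (k - i) / (i - l).+1%:R
  = (l == k)%:R.
Proof.
(* With [i = l + r], the trinomial identity pulls out ['C(k, l)] and leaves [sum_bin_bernoulli] at
   [k - l]. *)
move=> /subnKC; set m := (k - l)%N => <-; rewrite -addnS big_split_ord /= big1.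
  rewrite add0r; under eq_bigr => r _.
    rewrite -natrM mul_bin_trinomial ?leq_addr ?leq_add2l -1?ltnS //.
    rewrite subnDl !addKn natrM -!mulrA [X in _ * X]mulrA.
    over.
  rewrite -mulr_sumr sum_bin_bernoulli.
  have -> : (l == l + m)%N = (m == 0%N).
    by rewrite -[X in X == _]addn0 eqn_add2l eq_sym.
  by case: eqP => [->|]; rewrite ?mulr0 // addn0 binn mulr1.
by move=> i _; rewrite [X in _ * X%:R]bin_small // mulr0 !mul0r.
Qed.

Lemma faulhaberS (k : nat) (x : rat) :
  faulhaber k (x + 1) = faulhaber k x + x ^+ k.
Proof.
apply/eqP; rewrite [eqbRHS]addrC -subr_eq /faulhaber -sumrB; apply/eqP.
(* The coefficient of [x ^ l] coming from the [i]-th summand. It vanishes for [l > i], so the inner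
   sum may run up to [k] and the two sums can be exchanged. *)
pose T i l : rat :=
  'C(k, i)%:R * 'C(i, l)%:R * bernoulli (k - i) / (i - l).+1%:R.
transitivity (\sum_(i < k.+1) \sum_(l < k.+1) T i l * x ^+ l).
  apply: eq_bigr => i _; rewrite -mulrBr -mulrBl exprD1n big_ord_recr /=.
  rewrite binn mulr1n addrK.
  rewrite [RHS](bigID (fun l : 'I_k.+1 => (l < i.+1)%N)) /= [X in _ + X]big1.
    rewrite addr0 -(big_ord_widen _ (fun l => T i l * x ^+ l)) //.
    rewrite big_distrl big_distrr /=; apply: eq_bigr => l _.
    have le_li : (l <= i)%N by rewrite -ltnS.
    have bin_eq : 'C(i.+1, l)%:R = i.+1%:R * 'C(i, l)%:R / (i - l).+1%:R :> rat.
      apply: (canRL (mulfK _)); first by rewrite pnatr_eq0.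
      by rewrite -!natrM mulnC -subSn // -mul_bin_down.
    rewrite -[_ *+ 'C(i.+1, _)]mulr_natr bin_eq /T.
    have i1_neq0 : i.+1%:R != 0 :> rat by rewrite pnatr_eq0.
    have il_neq0 : (i - l).+1%:R != 0 :> rat by rewrite pnatr_eq0.
    move: i.+1%:R (i - l).+1%:R i1_neq0 il_neq0 => u v u_neq0 v_neq0.
    by field; rewrite u_neq0 v_neq0.
  move=> l; rewrite -leqNgt => lt_il.
  by rewrite /T [X in _ * X%:R]bin_small // mulr0 !mul0r.
rewrite exchange_big /=; under eq_bigr => l _.
  rewrite -mulr_suml sum_trinomial_bernoulli -1?ltnS //; over.
rewrite big_ord_recr /= eqxx mul1r big1 ?add0r // => l _.
by rewrite ltn_eqF // mul0r.
Qed.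

Lemma sum_expr_faulhaber (k n : nat) :
  \sum_(j < n) j%:R ^+ k = faulhaber k n%:R.
Proof.
elim: n => [|n IHn].
  by rewrite big_ord0 /faulhaber big1 // => i _; rewrite expr0n /= mul0r mulr0.
by rewrite big_ord_recr /= IHn -natr1 faulhaberS.
Qed.

(** Since [numq x] and [denq x] are coprime, [denq x] divides every [d] that clears the denominator
    of [x]. *)
Lemma local_intP (n : nat) (x : rat) :
  reflect (exists2 d : nat, coprime n d & d%:R * x \is a Num.int)
          (coprime n `|denq x|).
Proof.
apply: (iffP idP) => [co_nx | [d co_nd /intrP[m dx_m]]].
  exists `|denq x|%N => //.
  by rewrite pmulrn absz_denq mulrC -numqE intr_int.
apply: coprime_dvdr co_nd; rewrite -[d]/(`|d%:Z|%N) -dvdzE.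
rewrite -(@Gauss_dvdzl _ _ (numq x)); last first.
  by rewrite coprimez_sym coprimezE coprime_num_den.
apply/dvdzP; exists m; apply: (@intr_inj rat).
by rewrite !intrM numqE mulrA dx_m.
Qed.

(** The localization of the integers at the primes dividing [n], phrased through the denominator so
    that for [B_k] it becomes the gcd condition. *)
Definition local_int_pred (n : nat) : {pred rat} :=
  fun x => coprime n `|denq x|.

Definition local_int (n : nat) := [qualify a x : rat | local_int_pred n x].

Lemma local_int_subring (n : nat) : subring_closed (local_int_pred n).
Proof.
split=> [|x y|x y]; rewrite !unfold_in /local_int_pred ?coprimen1 //.
  move=> /local_intP[d co_d dx] /local_intP[e co_e ey].
  apply/local_intP; exists (d * e)%N; first by rewrite coprimeMr co_d.
  rewrite natrM mulrBr rpredB //; last by rewrite -mulrA rpredM ?natr_int.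
  by rewrite mulrAC rpredM ?natr_int.
move=> /local_intP[d co_d dx] /local_intP[e co_e ey].
apply/local_intP; exists (d * e)%N; first by rewrite coprimeMr co_d.
by rewrite natrM mulrACA rpredM.
Qed.

HB.instance Definition _ (n : nat) :=
  GRing.isSubringClosed.Build rat (local_int_pred n) (local_int_subring n).

(** Bezout gives [b n - a d = 1], which writes [x] as a combination of the integers [n x] and
    [d x]. *)
Lemma local_int_int (n : nat) (x : rat) :
  (0 < n)%N -> n%:R * x \is a Num.int ->
  (x \is a Num.int) = (x \is a local_int n).
Proof.
move=> n_gt0 nx; apply/idP/idP => [x_int|]; first exact: rpred_int_num.
rewrite qualifE /= /local_int_pred => /local_intP[d co_nd dx].
have [a _ /dvdnP[b n_dvd]] := Bezoutl d n_gt0.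
have -> : x = b%:R * (n%:R * x) - a%:R * (d%:R * x).
  rewrite !mulrA -mulrBl -!natrM -n_dvd natrD addrK.
  by move: co_nd => /eqP ->; rewrite mul1r.
by rewrite rpredB // rpredM ?natr_int.
Qed.

(** For a prime [p] dividing [n] and [m], with [v = logn p m], [2 ^ v <= p ^ v <= m < 2 ^ a.+1]
    forces [v <= a]. So the part of [m] built from primes of [n] divides [n ^ a], and the cofactor
    is prime to [n]. *)
Lemma local_int_expn_div (n m a : nat) :
  (0 < n)%N -> (0 < m)%N -> (m < 2 ^ a.+1)%N ->
  n%:R ^+ a / m%:R \is a local_int n.
Proof.
move=> n_gt0 m_gt0 lt_m.
have part_dvd : (m`_\pi(n) %| n ^ a)%N.
  apply/dvdn_partP => [|p]; first exact: part_gt0.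
  rewrite pi_of_part // inE /= => /andP[p_m p_n].
  have p_pr : prime p by move: p_m; rewrite mem_primes => /andP[].
  rewrite partn_part; last by move=> q /eqnP ->.
  rewrite p_part pfactor_dvdn // ?expn_gt0 ?n_gt0 // lognX.
  have le_a : (logn p m <= a)%N.
    rewrite -ltnS -(ltn_exp2l _ _ (isT : 1 < 2)%N).
    apply: leq_ltn_trans lt_m.
    apply: leq_trans (dvdn_leq m_gt0 (pfactor_dvdnn p m)).
    by case: (logn p m) => // e; rewrite leq_exp2r // prime_gt1.
  by apply: leq_trans le_a _; rewrite leq_pmulr // logn_gt0.
rewrite qualifE /= /local_int_pred; apply/local_intP; exists (m`_(\pi(n)^'))%N.
  by rewrite coprime_pi' // part_pnat.
have m_neq0 : m%:R != 0 :> rat by rewrite pnatr_eq0 -lt0n.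
have /dvdnP[q n_q] := part_dvd.
have -> : (m`_(\pi(n)^'))%N%:R * (n%:R ^+ a / m%:R) = q%:R :> rat.
  rewrite mulrA; apply: (canLR (mulfK m_neq0)).
  have -> : m%:R = (m`_\pi(n))%N%:R * (m`_\pi(n)^')%N%:R :> rat.
    by rewrite -natrM partnC.
  by rewrite -natrX n_q natrM; ring.
exact: natr_int.
Qed.

Lemma local_int_mul_bernoulli (n j : nat) :
  (0 < n)%N -> n%:R * bernoulli j \is a local_int n.
Proof.
move=> n_gt0; elim/ltn_ind: j => j IHj.
have := sum_expr_faulhaber j n; rewrite /faulhaber big_ord_recl /=.
rewrite bin0 mul1r subn0 expr1 divr1 mulrC => /(canLR (addrK _)) <-.
apply: rpredB; first by apply: rpred_sum => i _; rewrite rpredX ?rpred_nat.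
apply: rpred_sum => i _; rewrite /bump /= add1n.
(* One factor [n] goes to the earlier Bernoulli number; the remaining ones absorb [i + 2]. *)
have -> : 'C(j, i.+1)%:R * bernoulli (j - i.+1) * (n%:R ^+ i.+2 / i.+2%:R)
    = 'C(j, i.+1)%:R * (n%:R * bernoulli (j - i.+1))
      * (n%:R ^+ i.+1 / i.+2%:R) by rewrite exprS; ring.
apply: rpredM.
  rewrite rpredM ?rpred_nat // IHj // ltn_subrL.
  by rewrite (leq_ltn_trans _ (ltn_ord i)).
by rewrite local_int_expn_div // ltn_expl.
Qed.

Lemma mean_power_sub_bernoulli (k n : nat) :
  (2 <= k)%N -> ~~ odd k -> (0 < n)%N ->
  mean_power k n - bernoulli k \is a local_int n.
Proof.
move=> k_ge2 k_even n_gt0.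
have n_neq0 : n%:R != 0 :> rat by rewrite pnatr_eq0 -lt0n.
have k_gt0 : (0 < k)%N by exact: ltnW.
(* [faulhaber] sums over [0 <= j < n]: the term at [0] vanishes as [k > 0], and [n ^ k] is added. *)
have sum_eq :
  \sum_(1 <= j < n.+1) j%:R ^+ k = faulhaber k n%:R + n%:R ^+ k :> rat.
  rewrite -sum_expr_faulhaber.
  transitivity (\sum_(j < n.+1) j%:R ^+ k : rat); last by rewrite big_ord_recr.
  rewrite -(big_mkord xpredT (fun j => j%:R ^+ k)) big_ltn //.
  by rewrite expr0n eqn0Ngt k_gt0 add0r.
rewrite /mean_power sum_eq /faulhaber.
case: k k_ge2 k_even {k_gt0 sum_eq} => [|[|k]] // _ k_even.
rewrite 2!big_ord_recl /= bin0 bin1 subn0 mul1r expr1 divr1.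
rewrite /bump /= addn0 subSS subn0.
(* The term over [2] stands apart: division by [n] leaves it only the [n] that the Bernoulli number
   needs, so the parity of [k] must cancel the [2]. *)
have -> S : (bernoulli k.+2 * n%:R
    + (k.+2%:R * bernoulli k.+1 * (n%:R ^+ 2 / 2%:R) + S) + n%:R ^+ k.+2) / n%:R
    - bernoulli k.+2
  = (k./2.+1)%:R * (n%:R * bernoulli k.+1) + S / n%:R + n%:R ^+ k.+1.
  have -> : k.+2%:R = (k./2.+1)%:R * 2%:R :> rat.
    by rewrite -natrM muln2 doubleS -[in LHS](even_halfK k_even).
  by rewrite !exprS; field.
rewrite !rpredD ?rpredX ?rpred_nat //.
  by rewrite rpredM ?rpred_nat // local_int_mul_bernoulli.
rewrite big_distrl /=; apply: rpred_sum => i _; rewrite !add1n.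
have -> : 'C(k.+2, i.+2)%:R * bernoulli (k.+2 - i.+2)
      * (n%:R ^+ i.+3 / i.+3%:R) / n%:R
    = 'C(k.+2, i.+2)%:R * (n%:R * bernoulli (k.+2 - i.+2))
      * (n%:R ^+ i.+1 / i.+3%:R) :> rat.
  by rewrite !exprS; move: i.+3%:R^-1 => u; field.
apply: rpredM; first by rewrite rpredM ?rpred_nat ?local_int_mul_bernoulli.
rewrite local_int_expn_div //.
have lt_pow : (i.+1 < 2 ^ i.+1)%N by exact: ltn_expl.
rewrite [(2 ^ i.+2)%N]expnS mul2n -addnn.
by apply: leq_trans (leq_add lt_pow lt_pow); rewrite 2!addSnnS leq_addl.
Qed.

Theorem theorem2 (k n : nat) (N D : int)
  (k_ge2 : (2 <= k)%N) (k_even : ~~ odd k) (n_ge1 : (1 <= n)%N)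
  (coprime_ND : coprimez N D) (D_ge1 : 1 <= D)
  (Bk_eq : bernoulli k = N%:~R / D%:~R) :
  mean_power k n \is a Num.int <-> gcdz n%:Z D = 1.
Proof.
have D_gt0 : 0 < D by rewrite gtz0_ge1.
have denB : denq (bernoulli k) = D.
  by rewrite Bk_eq coprimeq_den -?coprimezE // gt_eqF // gtr0_norm.
rewrite (@local_int_int n) //; last first.
  rewrite mulrC divfK ?pnatr_eq0 -?lt0n //.
  by apply: rpred_sum => j _; rewrite rpredX ?natr_int.
rewrite -[mean_power k n](subrK (bernoulli k)).
(* The difference lies in the subring, so the mean does exactly when [bernoulli k] does. *)
rewrite rpredDl ?mean_power_sub_bernoulli // unfold_in /local_int_pred denB.
by split=> [/eqP co_nD | [/eqP]] //; rewrite /gcdz co_nD.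
Qed.
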